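(* Let $d\ge0$ be an integer, $z_0=(x_0,y_0)\in\mathbb{Z}^2$, and let ${\cal A}_d(z_0)$ be an optimal tristance anticode of diameter $d$ in the grid graph ${\cal G}_2$ centered about $z_0$. If $d$ is even, then ${\cal A}_d(z_0)={\mathscr S}_{d/2}(z_0)$. If $d$ is odd, then ${\cal A}_d(z_0)={\mathscr S}_{d/2}(z_0+\xi)$ for some $\xi\in\{(\tfrac12,0),(0,\tfrac12),(-\tfrac12,0),(0,-\tfrac12)\}$.
   Context: The grid graph ${\cal G}_2$ has vertex set $\mathbb{Z}^2$, with $z,z'$ adjacent iff their $L_1$-distance is $1$. For $z_1,z_2,z_3\in\mathbb{Z}^2$, the tristance $d_3(z_1,z_2,z_3)$ is the minimum number of edges of a tree in ${\cal G}_2$ (possibly using additional vertices) containing $z_1,z_2,z_3$. A set ${\cal A}\subset\mathbb{Z}^2$ is a tristance anticode of diameter $d$ centered about $z_0$ if $d_3(z_0,z_1,z_2)\le d$ for all $z_1,z_2\in{\cal A}$; it is optimal if it has the largest possible cardinality among such sets. For $w=(w_1,w_2)\in\mathbb{R}^2$ and real $\rho$, ${\mathscr S}_\rho(w)=\{(x,y)\in\mathbb{Z}^2: |x-w_1|+|y-w_2|\le\rho\}$. *)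

(* Defs.v *)
From mathcomp Require Import all_boot all_order all_algebra finmap.
From mathcomp Require Import all_classical all_reals.
From mathcomp Require Import zify.

Set Implicit Arguments.
Unset Strict Implicit.
Unset Printing Implicit Defensive.

Import Order.TTheory GRing.Theory Num.Theory.

Local Open Scope classical_set_scope.
Local Open Scope fset_scope.
Local Open Scope ring_scope.

Notation gpoint := (int * int)%type.

Definition L1_dist (z z' : gpoint) : int := `|z.1 - z'.1| + `|z.2 - z'.2|.

Definition grid_adj : rel gpoint := [rel z z' | L1_dist z z' == 1].

(* A finite subgraph of the grid graph is a finite set [V] of vertices together
   with a finite set [E] of edges, an edge being the two-element set of its
   endpoints. *)
Definition grid_subgraph (V : {fset gpoint}) (E : {fset {fset gpoint}}) : Prop :=
  forall e, e \in E ->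
    exists u v, [/\ e = [fset u; v], u \in V, v \in V & grid_adj u v].

Definition edge_rel (E : {fset {fset gpoint}}) : rel gpoint :=
  [rel u v | [fset u; v] \in E].

Definition subgraph_connected (V : {fset gpoint}) (E : {fset {fset gpoint}}) :
    Prop :=
  V != fset0 /\
  forall u v, u \in V -> v \in V ->
    exists2 p : seq gpoint, path (edge_rel E) u p & last u p = v.

Definition subgraph_acyclic (E : {fset {fset gpoint}}) : Prop :=
  forall c : seq gpoint, (3 <= size c)%N -> ~~ (uniq c && cycle (edge_rel E) c).

Definition grid_tree (V : {fset gpoint}) (E : {fset {fset gpoint}}) : Prop :=
  [/\ grid_subgraph V E, subgraph_connected V E & subgraph_acyclic E].

Definition tree_spans3 (z1 z2 z3 : gpoint) (n : nat) : Prop :=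
  exists (V : {fset gpoint}) (E : {fset {fset gpoint}}),
    [/\ grid_tree V E, z1 \in V, z2 \in V, z3 \in V & #|` E| = n].

(* The facts down to [tree_spans3_ex] show that any three points lie in a
   common tree, so that the minimum defining [tristance] exists. *)

Lemma grid_adjC z z' : grid_adj z z' = grid_adj z' z.
Proof. by rewrite /grid_adj /= /L1_dist distrC [X in _ + X]distrC. Qed.

Lemma edge_relC E u v : edge_rel E u v = edge_rel E v u.
Proof. by rewrite /edge_rel /= fsetUC. Qed.

Lemma edge_vertices V E u v : grid_subgraph V E -> edge_rel E u v ->
  [/\ u \in V, v \in V & grid_adj u v].
Proof.
move=> sVE /sVE [a [b [eab aV bV ab]]].
have uab : u \in [fset a; b] by rewrite -eab !inE eqxx.
have vab : v \in [fset a; b] by rewrite -eab !inE eqxx orbT.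
have auv : a \in [fset u; v] by rewrite eab !inE eqxx.
have buv : b \in [fset u; v] by rewrite eab !inE eqxx orbT.
move: uab vab auv buv; rewrite !inE.
case/orP => /eqP -> /orP[] /eqP -> //.
- by move=> _ /orP[] /eqP ba; rewrite ba in ab bV *.
- by rewrite grid_adjC.
- by move=> /orP[] /eqP ba _; rewrite ba in ab aV *.
Qed.

Lemma grid_tree_leaf V E v u : grid_tree V E -> v \in V -> grid_adj v u ->
  u \notin V -> grid_tree (u |` V) ([fset v; u] |` E).
Proof.
move=> [sVE [V0 cVE] aE] vV vu uV.
set E' := [fset v; u] |` E.
have sub w w' : edge_rel E w w' -> edge_rel E' w w'.
  by rewrite /edge_rel /E' /= !inE => ->; rewrite orbT.
have vu' : edge_rel E' v u by rewrite /edge_rel /E' /= !inE eqxx.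
have old w w' : w != u -> w' != u -> edge_rel E' w w' -> edge_rel E w w'.
  move=> wu w'u; rewrite /edge_rel /E' /= in_fset1U => /orP[/eqP e|//].
  have : u \in [fset w; w'] by rewrite e !inE eqxx orbT.
  by rewrite !inE eq_sym (negbTE wu) eq_sym (negbTE w'u).
have new w : edge_rel E' u w -> w = v.
  rewrite {1}/edge_rel /E' /= in_fset1U => /orP[/eqP e|uw]; last first.
    by have [] := edge_vertices sVE uw; rewrite (negbTE uV).
  have : v \in [fset u; w] by rewrite e !inE eqxx.
  rewrite !inE => /orP[/eqP evu|/eqP//].
  by move: uV; rewrite -evu vV.
split.
- move=> e; rewrite in_fset1U => /orP[/eqP ->|/sVE [a [b [-> aV bV ab]]]].
    by exists v, u; split=> //; rewrite !inE ?eqxx // vV orbT.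
  by exists a, b; split=> //; rewrite !inE ?aV ?bV orbT.
- split; first by apply/fset0Pn; exists u; rewrite !inE eqxx.
  have c1 a b : a \in V -> b \in V ->
      exists2 p : seq gpoint, path (edge_rel E') a p & last a p = b.
    move=> aV bV; have [p pp lp] := cVE _ _ aV bV.
    by exists p => //; apply: sub_path pp => x y; apply: sub.
  move=> a b; rewrite !inE => /orP[/eqP ->|aV] /orP[/eqP ->|bV].
  + by exists [::].
  + have [p pp lp] := c1 _ _ vV bV.
    by exists (v :: p) => //=; rewrite edge_relC vu'.
  + have [p pp lp] := c1 _ _ aV vV.
    by exists (rcons p u); rewrite ?last_rcons // rcons_path pp lp.
  + exact: c1.
- move=> c sc; apply/negP => /andP[uc cc].
  have [cu|cu] := boolP (u \in c); last first.
    have := aE c sc; rewrite uc /= => /negP; apply.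
    case: c sc uc cc cu => // x c _ _ cc cu.
    apply: (sub_in_cycle (P := [pred z | z != u]) (e := edge_rel E')) cc.
      by move=> y z yu zu; apply: old.
    apply/allP => y yc; rewrite inE; apply: contraNneq cu => <-; exact: yc.
  have [i c' ec] := rot_to cu.
  have : cycle (edge_rel E') (u :: c') by rewrite -ec rot_cycle.
  have : uniq (u :: c') by rewrite -ec rot_uniq.
  have : (3 <= size (u :: c'))%N by rewrite -ec size_rot.
  case: c' {ec} => // x; case/lastP => // q y _ /=.
  rewrite rcons_path last_rcons mem_rcons !inE.
  move=> /and3P[_ /norP [xy _] _] /andP[/new ex /andP[_]].
  by rewrite edge_relC => /new ey; rewrite ex ey eqxx in xy.
Qed.

Lemma grid_tree_extend V E p v : grid_tree V E -> v \in V ->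
  path grid_adj v p -> exists V' E',
  [/\ grid_tree V' E', (V `<=` V')%fset & last v p \in V'].
Proof.
elim: p v V E => [|u p IH] v V E tVE vV /=; first by exists V, E.
case/andP=> vu pp; have [uV|uV] := boolP (u \in V); first exact: (IH u V E).
have tV' := grid_tree_leaf tVE vV vu uV.
have [|V' [E' [t' sub l']]] := IH u _ _ tV' _ pp; first by rewrite !inE eqxx.
by exists V', E'; split=> //; apply: fsubset_trans sub; apply: fsubsetU1.
Qed.

Lemma grid_path z z' : exists2 p, path grid_adj z p & last z p = z'.
Proof.
have [n] := ubnP `|L1_dist z z'|%N; elim: n z => // n IH z.
rewrite ltnS => zn.
have step u : grid_adj z u -> (`|L1_dist u z'| < `|L1_dist z z'|)%N ->
    exists2 p, path grid_adj z p & last z p = z'.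
  move=> zu lt; have [p pp lp] := IH u (leq_trans lt zn).
  by exists (u :: p) => //=; rewrite zu.
case: z z' zn step {IH} => [x y] [x' y'] _ step.
have [xx'|x'x|exx] := ltgtP x x'.
- by apply: (step (x + 1, y)); rewrite /grid_adj /= /L1_dist /=; lia.
- by apply: (step (x - 1, y)); rewrite /grid_adj /= /L1_dist /=; lia.
have [yy'|y'y|eyy] := ltgtP y y'.
- by apply: (step (x, y + 1)); rewrite /grid_adj /= /L1_dist /=; lia.
- by apply: (step (x, y - 1)); rewrite /grid_adj /= /L1_dist /=; lia.
by exists [::] => //=; rewrite exx eyy.
Qed.

Lemma grid_tree1 z : grid_tree [fset z] fset0.
Proof.
split; first by move=> e; rewrite inE.
  split; first by apply/fset0Pn; exists z; rewrite inE.
  by move=> u v; rewrite !inE => /eqP -> /eqP ->; exists [::].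
by case=> [//|x [//|y c]] _; rewrite /= andbF.
Qed.

Lemma tree_spans3_ex z1 z2 z3 : exists n, `[< tree_spans3 z1 z2 z3 n >].
Proof.
have z11 : z1 \in [fset z1] by rewrite inE.
have [p pp <-] := grid_path z1 z2; have [q qq <-] := grid_path z1 z3.
have [V [E [t s l]]] := grid_tree_extend (grid_tree1 z1) z11 pp.
have z1V := fsubsetP s _ z11.
have [V' [E' [t' s' l']]] := grid_tree_extend t z1V qq.
exists #|` E'|; apply/asboolP; exists V', E'; split=> //.
  exact: (fsubsetP s').
exact: (fsubsetP s').
Qed.

Definition tristance (z1 z2 z3 : gpoint) : nat :=
  ex_minn (tree_spans3_ex z1 z2 z3).

Definition tristance_anticode (d : nat) (z0 : gpoint) (A : set gpoint) : Prop :=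
  forall z1 z2, A z1 -> A z2 -> (tristance z0 z1 z2 <= d)%N.

Definition optimal_tristance_anticode (d : nat) (z0 : gpoint) (A : set gpoint) :
    Prop :=
  tristance_anticode d z0 A /\
  forall B, tristance_anticode d z0 B -> (B #<= A)%card.

Definition L1_ball (R : realType) (rho : R) (w : R * R) : set gpoint :=
  [set z | `|z.1%:~R - w.1| + `|z.2%:~R - w.2| <= rho].

Definition point_to_plane (R : realType) (z : gpoint) : R * R :=
  (z.1%:~R, z.2%:~R).

(* Main.v *)
(* The tristance is at least the width plus the height of the bounding box of
   the three points, in particular at least the L1-distance of any two of them.
   Hence an anticode has L1-diameter at most [d] and lies in a square of side [d]
   in the coordinates [x + y] and [x - y], i.e. in a ball of radius [d / 2] about
   some half-integral point.  Among these balls the ones of the theorem are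
   anticodes and have the largest cardinality, so an optimal anticode is a whole
   ball; applying the bounding box estimate to its extreme points then locates
   its center. *)

Require Import Defs.
From mathcomp Require Import all_boot all_order all_algebra.
From mathcomp Require Import all_classical all_reals.
From mathcomp Require Import finmap zify.

Set Implicit Arguments.
Unset Strict Implicit.
Unset Printing Implicit Defensive.

Import Order.TTheory GRing.Theory Num.Theory.

Local Open Scope classical_set_scope.
Local Open Scope ring_scope.

(** * Upper bound: trees grown along geodesics *)

Lemma grid_geodesic z z' :
  exists p, [/\ path grid_adj z p, last z p = z' & (size p)%:Z = L1_dist z z'].
Proof.
have [n] := ubnP `|L1_dist z z'|%N; elim: n z => // n IH z.
rewrite ltnS => zn.
have step u : grid_adj z u -> L1_dist z z' = L1_dist u z' + 1 ->
    exists p, [/\ path grid_adj z p, last z p = z' &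
                  (size p)%:Z = L1_dist z z'].
  move=> zu du.
  have [|p [pp lp sp]] := IH u; first by move: du zn; rewrite /L1_dist; lia.
  by exists (u :: p); split=> //=; [rewrite zu | rewrite du -sp; lia].
case: z z' zn step {IH} => [x y] [x' y'] _ step.
have [xx'|x'x|exx] := ltgtP x x'.
- by apply: (step (x + 1, y)); rewrite /grid_adj /= /L1_dist /=; lia.
- by apply: (step (x - 1, y)); rewrite /grid_adj /= /L1_dist /=; lia.
have [yy'|y'y|eyy] := ltgtP y y'.
- by apply: (step (x, y + 1)); rewrite /grid_adj /= /L1_dist /=; lia.
- by apply: (step (x, y - 1)); rewrite /grid_adj /= /L1_dist /=; lia.
by exists [::]; split=> //=; rewrite ?exx ?eyy // /L1_dist /=; lia.
Qed.

(** A step of the walk to a vertex already in the tree costs nothing, and a step to a new vertex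
    adds a leaf, hence one edge and no cycle. *)
Lemma grid_tree_extend_card V E p v : grid_tree V E -> v \in V ->
  path grid_adj v p -> exists V' E',
  [/\ grid_tree V' E', (V `<=` V')%fset, last v p \in V' &
      (#|` E'| <= #|` E| + size p)%N].
Proof.
elim: p v V E => [|u p IH] v V E tVE vV /=.
  by exists V, E; split=> //; rewrite addn0.
case/andP=> vu pp; have [uV|uV] := boolP (u \in V).
  have [V' [E' [t' s' l' c']]] := IH u V E tVE uV pp.
  by exists V', E'; split=> //; rewrite addnS leqW.
have tV' := grid_tree_leaf tVE vV vu uV.
have [|V' [E' [t' sub l' c']]] := IH u _ _ tV' _ pp; first by rewrite !inE eqxx.
exists V', E'; split=> //; first by apply: fsubset_trans sub; apply: fsubsetU1.
by move: c'; rewrite cardfsU1; case: (_ \notin _) => /=; lia.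
Qed.

(** The tree grows from [w] along a geodesic to each point in turn; overlaps only save edges. *)
Lemma tristance_le_star w z1 z2 z3 :
  (tristance z1 z2 z3)%:Z <= L1_dist w z1 + L1_dist w z2 + L1_dist w z3.
Proof.
have w1 : w \in [fset w]%fset by rewrite inE.
have [p1 [pp1 l1 <-]] := grid_geodesic w z1.
have [p2 [pp2 l2 <-]] := grid_geodesic w z2.
have [p3 [pp3 l3 <-]] := grid_geodesic w z3.
have [V1 [E1 [t1 s1 m1 c1]]] := grid_tree_extend_card (grid_tree1 w) w1 pp1.
have wV1 := fsubsetP s1 _ w1.
have [V2 [E2 [t2 s2 m2 c2]]] := grid_tree_extend_card t1 wV1 pp2.
have wV2 := fsubsetP s2 _ wV1.
have [V3 [E3 [t3 s3 m3 c3]]] := grid_tree_extend_card t2 wV2 pp3.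
rewrite cardfs0 in c1.
rewrite /tristance; case: ex_minnP => m _ /(_ #|` E3|) le_m.
have /le_m : `[< tree_spans3 z1 z2 z3 #|` E3| >].
  apply/asboolP; exists V3, E3; split=> //.
  - by rewrite -l1; apply/(fsubsetP s3)/(fsubsetP s2).
  - by rewrite -l2; apply/(fsubsetP s3).
  - by rewrite -l3.
rewrite -!PoszD lez_nat => le_mE; apply: (leq_trans le_mE).
by rewrite (leq_trans c3) // leq_add2r (leq_trans c2) // leq_add2r.
Qed.

(** * Lower bound: edges crossing the lines between lattice points *)

(** Discrete intermediate value theorem: [f] changes by at most one along an edge, so a path cannot
    jump over the gap from [t] to [t + 1]. *)
Lemma crossing_edge (f : gpoint -> int) V E u p t : grid_subgraph V E ->
  (forall a b, grid_adj a b -> `|f a - f b| <= 1) ->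
  path (edge_rel E) u p -> f u <= t -> t < f (last u p) ->
  exists a b, [/\ [fset a; b]%fset \in E, grid_adj a b, f a = t & f b = t + 1].
Proof.
move=> sVE lip; elim: p u => [|v p IH] u /=; first by move=> _; lia.
move=> /andP[uv pp] ut tl; have [vt|vt] := leP (f v) t; first exact: (IH v).
have [_ _ adj_uv] := edge_vertices sVE uv.
by have := lip _ _ adj_uv; exists u, v; split=> //; lia.
Qed.

(* The coordinates of the two endpoints of an edge have an odd sum exactly in the
   direction of the edge, so the label separates edges that cross different
   vertical or horizontal lines [x = t + 1/2], [y = t + 1/2]. *)
Definition edge_label (e : {fset gpoint}) : bool * int :=
  let sx := \sum_(z <- e) z.1 in
  if (sx %% 2 == 1)%Z then (true, sx) else (false, \sum_(z <- e) z.2).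

Lemma edge_labelE a b : a != b -> edge_label [fset a; b]%fset =
  if ((a.1 + b.1) %% 2 == 1)%Z then (true, a.1 + b.1) else (false, a.2 + b.2).
Proof.
move=> ab; rewrite /edge_label.
by rewrite !big_fsetU1 ?inE //= !big_seq_fset1.
Qed.

(** Each line separating [Q] from [P] or [T] from [S] is crossed by some edge, and different lines
    give different labels, so it suffices to count labels. *)
Lemma connected_card_edges V E (P Q S T : gpoint) :
  grid_subgraph V E -> subgraph_connected V E ->
  P \in V -> Q \in V -> S \in V -> T \in V ->
  Q.1 <= P.1 -> T.2 <= S.2 ->
  (P.1 - Q.1) + (S.2 - T.2) <= #|` E|%:Z.
Proof.
move=> sVE [_ cVE] PV QV SV TV QP TS.
pose m := absz (P.1 - Q.1); pose n := absz (S.2 - T.2).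
pose labels :=
  (* An edge from [t] to [t + 1] in its direction has coordinate sum [2 * t + 1] there. *)
  [seq (true, 2 * (Q.1 + i%:Z) + 1) | i <- iota 0 m] ++
  [seq (false, 2 * (T.2 + i%:Z) + 1) | i <- iota 0 n].
suff le : (size labels <= #|` [fset edge_label e | e in E]%fset|)%N.
  have := leq_trans le (leq_imfset_card _ _ _).
  rewrite size_cat !size_map !size_iota -lez_nat PoszD /m /n.
  by rewrite !gez0_abs ?subr_ge0.
apply: uniq_leq_size.
  rewrite cat_uniq !map_inj_uniq ?iota_uniq //=; last 2 first.
  - by move=> i j []; lia.
  - by move=> i j []; lia.
  rewrite andbT; apply/hasPn => _ /mapP[i _ ->]; apply/negP.
  by move=> /mapP[j _].
move=> l; rewrite mem_cat => /orP[] /mapP[i]; rewrite mem_iota => lt_i ->.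
- have [p pp lp] := cVE _ _ QV PV.
  have [|||a [b [abE ab fa fb]]] :=
    @crossing_edge fst V E Q p (Q.1 + i%:Z) sVE _ pp.
  + by move=> a b; rewrite /grid_adj /= /L1_dist; lia.
  + by lia.
  + by rewrite lp; lia.
  apply/imfsetP; exists [fset a; b]%fset => //.
  rewrite edge_labelE; last by apply/eqP => eab; move: fb; rewrite -eab fa; lia.
  by rewrite fa fb; case: ifP; [move=> _; congr pair; lia | lia].
- have [p pp lp] := cVE _ _ TV SV.
  have [|||a [b [abE ab fa fb]]] :=
    @crossing_edge snd V E T p (T.2 + i%:Z) sVE _ pp.
  + by move=> a b; rewrite /grid_adj /= /L1_dist; lia.
  + by lia.
  + by rewrite lp; lia.
  apply/imfsetP; exists [fset a; b]%fset => //.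
  rewrite edge_labelE; last by apply/eqP => eab; move: fb; rewrite -eab fa; lia.
  move: ab; rewrite /grid_adj /= /L1_dist fa fb => ab.
  by case: ifP; [lia | move=> _; congr pair; lia].
Qed.

Lemma tristance_ge_box (z1 z2 z3 P Q S T : gpoint) :
  P \in [:: z1; z2; z3] -> Q \in [:: z1; z2; z3] ->
  S \in [:: z1; z2; z3] -> T \in [:: z1; z2; z3] ->
  (P.1 - Q.1) + (S.2 - T.2) <= (tristance z1 z2 z3)%:Z.
Proof.
rewrite /tristance; case: ex_minnP => n /asboolP [V [E [tVE m1 m2 m3 cE]]] _.
have [sVE cVE _] := tVE.
have sV P' : P' \in [:: z1; z2; z3] -> P' \in V.
  by rewrite !inE => /or3P[] /eqP ->.
move=> /sV PV /sV QV /sV SV /sV TV; rewrite -cE.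
(* A negative difference only weakens the bound: taking [P] for both points makes it zero. *)
wlog QP : P Q PV QV / Q.1 <= P.1.
  move=> wl; have [|lt] := leP Q.1 P.1; first exact: wl.
  by apply: le_trans (wl P P PV PV (lexx _)); rewrite lerD2r; lia.
wlog TS : S T SV TV / T.2 <= S.2.
  move=> wl; have [|lt] := leP T.2 S.2; first exact: wl.
  by apply: le_trans (wl S S SV SV (lexx _)); rewrite lerD2l; lia.
exact: (connected_card_edges sVE cVE PV QV SV TV QP TS).
Qed.

(** * Finite cardinalities and diamonds *)

Lemma finite_subset_card_eq (T : choiceType) (A B : set T) :
  finite_set B -> A `<=` B -> (B #<= A)%card -> A = B.
Proof.
move=> finB AB leBA; have finA := sub_finite_set AB finB.
have [n Bn] := finB.
have cB := card_fset_set Bn.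
have nA : (`I_n #<= A)%card by rewrite -(card_le_eql Bn).
apply: fset_set_inj => //; apply/eqP; rewrite eqEfcard cB.
by rewrite leq_card_fset_set // andbT -fset_set_sub.
Qed.

Lemma card_le_inj (T U : Type) (A : set T) (B : set U) (f : T -> U) :
  {in A &, injective f} -> (forall x, A x -> B (f x)) -> (A #<= B)%card.
Proof.
move=> injf fAB; rewrite -(card_le_eql (inj_card_eq injf)).
by apply: subset_card_le => _ [x Ax <-]; exact: fAB.
Qed.

(* [diamond d c1 c2] is the ball of radius [d / 2] centered at
   [(c1 / 2, c2 / 2)]. *)
Definition diamond (d : nat) (c1 c2 : int) : set gpoint :=
  [set z | `|2 * z.1 - c1| + `|2 * z.2 - c2| <= d%:Z].

(** Doubling the coordinates clears the halves, so that the remaining geometry is linear integer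
    arithmetic. *)
Lemma L1_ball_half (R : realType) d (c1 c2 : int) :
  L1_ball (d%:R / 2 : R) (c1%:~R / 2, c2%:~R / 2) = diamond d c1 c2.
Proof.
have half (x c : int) :
    `|x%:~R - c%:~R / 2 : R| = `|2 * x - c|%:~R / 2.
  have -> : x%:~R - c%:~R / 2 = (2 * x - c)%:~R / 2 :> R.
    by rewrite intrB intrM mulrBl [2%:~R * _]mulrC mulfK // pnatr_eq0.
  by rewrite normrM normfV [ `|2| ]gtr0_norm ?ltr0n // intr_norm.
apply/seteqP; split=> z /=; rewrite /L1_ball /diamond /= !half -mulrDl;
  by rewrite ler_pM2r ?invr_gt0 // -intrD -[d%:R]/((d%:Z)%:~R) ler_int.
Qed.

Lemma finite_diamond d c1 c2 : finite_set (diamond d c1 c2).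
Proof.
pose f (ij : nat * nat) : gpoint :=
  (ij.1%:Z - (`|c1| + d%:Z), ij.2%:Z - (`|c2| + d%:Z)).
pose n := (2 * (absz c1 + absz c2 + d) + 1)%N.
apply: (@sub_finite_set _ _ (f @` (`I_n `*` `I_n))); last first.
  by apply/finite_image/finite_setX; exact: finite_II.
move=> [x y]; rewrite /diamond /= => xy.
exists (absz (x + (`|c1| + d%:Z)), absz (y + (`|c2| + d%:Z))) => /=.
  by split; rewrite /n /=; lia.
by rewrite /f /=; congr pair; lia.
Qed.

(** * Diamonds as anticodes, and comparison of their sizes *)

Lemma diamond_anticode d (z0 : gpoint) :
  tristance_anticode d z0 (diamond d (2 * z0.1 + (odd d)%:Z) (2 * z0.2)).
Proof.
case: z0 => x0 y0 [x1 y1] [x2 y2]; rewrite /diamond /= => h1 h2.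
rewrite -lez_nat.
(* For odd [d], points with abscissa above [x0] are within [(d + 1) / 2] of [z0], the others within
   [(d - 1) / 2]. Two points of the first kind share the edge from [z0] to its right neighbour, so
   the star is centered there. *)
have [/andP[/andP[od lt1] lt2]|no] := boolP [&& odd d && (x0 < x1) & x0 < x2].
  apply: le_trans (tristance_le_star (x0 + 1, y0) _ _ _) _.
  by rewrite /L1_dist /=; lia.
apply: le_trans (tristance_le_star (x0, y0) _ _ _) _.
by rewrite /L1_dist /=; lia.
Qed.

(* An anticode has L1-diameter at most [d], so on it each of the coordinates
   [x + y] and [x - y] takes values in an interval of length [d]. *)
Lemma anticode_sub_diamond d z0 A : tristance_anticode d z0 A -> A !=set0 ->
  exists c1 c2 : int, (2 %| c1 + c2 - d%:Z)%Z /\ A `<=` diamond d c1 c2.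
Proof.
move=> acA [a Aa].
have L1A z1 z2 : A z1 -> A z2 -> L1_dist z1 z2 <= d%:Z.
  move=> A1 A2; have := acA _ _ A1 A2; rewrite -lez_nat; apply: le_trans.
  have i1 : z1 \in [:: z0; z1; z2] by rewrite !inE eqxx orbT.
  have i2 : z2 \in [:: z0; z1; z2] by rewrite !inE eqxx !orbT.
  have := tristance_ge_box i1 i2 i1 i2; have := tristance_ge_box i1 i2 i2 i1.
  have := tristance_ge_box i2 i1 i1 i2; have := tristance_ge_box i2 i1 i2 i1.
  by rewrite /L1_dist; lia.
have minA (f : gpoint -> int) :
    (forall z1 z2, A z1 -> A z2 -> f z1 - f z2 <= d%:Z) ->
    exists m : int, forall z, A z -> m <= f z /\ f z <= m + d%:Z.
  move=> fA.
  (* On [A], [f] is bounded below by [f a - d]; its least value is found by minimizing the natural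
     offset from this bound. *)
  have exP : exists n : nat, `[< exists2 z, A z & f z = f a - d%:Z + n%:Z >].
    by exists d; apply/asboolP; exists a; rewrite ?subrK.
  case: (ex_minnP exP) => n /asboolP[z Az fz] min_n.
  exists (f z) => w Aw; split; last by rewrite -lerBlDl; exact: fA.
  have wa : 0 <= f w - (f a - d%:Z) by rewrite opprB addrCA -opprB subr_ge0 fA.
  rewrite fz -lerBrDl -(gez0_abs wa) lez_nat min_n //.
  by apply/asboolP; exists w => //; rewrite gez0_abs // subrKC.
have [u uA] :
    exists m : int, forall z, A z -> m <= z.1 + z.2 /\ z.1 + z.2 <= m + d%:Z.
  by apply: minA => z1 z2 A1 A2; have := L1A _ _ A1 A2; rewrite /L1_dist; lia.
have [v vA] :
    exists m : int, forall z, A z -> m <= z.1 - z.2 /\ z.1 - z.2 <= m + d%:Z.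
  by apply: minA => z1 z2 A1 A2; have := L1A _ _ A1 A2; rewrite /L1_dist; lia.
(* The square has its center at [x + y = u + d / 2], [x - y = v + d / 2]; these are its doubled
   coordinates, and [c1 + c2 - d = 2 * u]. *)
exists (u + v + d%:Z), (u - v); split; first by lia.
by move=> z Az; have := uA _ Az; have := vA _ Az; rewrite /diamond /=; lia.
Qed.

(* Translations suffice when the centers agree modulo the lattice; for odd [d]
   the two remaining parity classes are exchanged by swapping the coordinates. *)
Lemma diamond_card_le d c1 c2 c1' c2' :
  (2 %| c1 + c2 - d%:Z)%Z -> (2 %| c1' + c2' - d%:Z)%Z ->
  odd d || (2 %| c1 - c1')%Z ->
  (diamond d c1 c2 #<= diamond d c1' c2')%card.
Proof.
move=> par par' oc; have [same|diff] := boolP (2 %| c1 - c1')%Z.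
  have [s es] : exists s : int, c1' - c1 = 2 * s.
    by exists ((c1' - c1) %/ 2)%Z; lia.
  have [t et] : exists t : int, c2' - c2 = 2 * t.
    by exists ((c2' - c2) %/ 2)%Z; lia.
  apply: (@card_le_inj _ _ _ _ (fun z => (z.1 + s, z.2 + t))).
    by move=> [x y] [x' y'] _ _ /= [] /addIr -> /addIr ->.
  by move=> z; rewrite /diamond /=; lia.
have [s es] : exists s : int, c1' - c2 = 2 * s.
  by exists ((c1' - c2) %/ 2)%Z; lia.
have [t et] : exists t : int, c2' - c1 = 2 * t.
  by exists ((c2' - c1) %/ 2)%Z; lia.
apply: (@card_le_inj _ _ _ _ (fun z => (z.2 + s, z.1 + t))).
  by move=> [x y] [x' y'] _ _ /= [] /addIr -> /addIr ->.
by move=> z; rewrite /diamond /=; lia.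
Qed.

(* In the coordinates [u = x + y] and [v = x - y] both diamonds are squares with
   [d + 1] values of each coordinate; moving every point one step back in the
   lexicographic order of [(u, v)] flips the parity of [u + v], and the last
   point of the target square is not attained. *)
Lemma diamond_card_lt d c1 c2 c1' c2' : ~~ odd d ->
  ~~ (2 %| c1)%Z -> ~~ (2 %| c2)%Z -> (2 %| c1')%Z -> (2 %| c2')%Z ->
  ~~ (diamond d c1' c2' #<= diamond d c1 c2)%card.
Proof.
move=> ed o1 o2 ev1 ev2; apply/negP => le.
have [s es] : exists s : int, c1' - c1 - 1 = 2 * s.
  by exists ((c1' - c1 - 1) %/ 2)%Z; lia.
have [t et] : exists t : int, c2' - c2 + 1 = 2 * t.
  by exists ((c2' - c2 + 1) %/ 2)%Z; lia.
have [k ek] : exists k : int, d%:Z = 2 * k by exists (d./2)%:Z; lia.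
have [m1 em1] : exists m1 : int, c1' + d%:Z = 2 * m1.
  by exists ((c1' + d%:Z) %/ 2)%Z; lia.
have [m2 em2] : exists m2 : int, c2' = 2 * m2 by exists (c2' %/ 2)%Z; lia.
(* Relative to the centers, [v] drops by one; from its least value it wraps to the greatest and [u]
   drops instead. There [u] is not least, because [c2] is odd and the corner least in both is not a
   lattice point. *)
pose f (z : gpoint) : gpoint :=
  if 2 * (z.1 - z.2) == c1 - c2 - d%:Z then (z.1 + s + k, z.2 + t - 1 - k)
  else (z.1 + s, z.2 + t).
have le' : (diamond d c1 c2 #<= diamond d c1' c2' `\ (m1, m2))%card.
  apply: (@card_le_inj _ _ _ _ f).
    move=> [x y] [x' y'] /set_mem + /set_mem; rewrite /diamond /f /=.
    by case: eqP => e1; case: eqP => e2 h1 h2 [] e3 e4; congr pair; lia.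
  move=> [x y]; rewrite /diamond /f /= => h.
  by case: eqP => e1; split => /=; [lia | move=> [] | lia | move=> []]; lia.
have mem_m : diamond d c1' c2' (m1, m2) by rewrite /diamond /=; lia.
have sub := @subDsetl _ (diamond d c1' c2') [set (m1, m2)].
have eqD := finite_subset_card_eq (finite_diamond _ _ _) sub
  (card_le_trans le le').
by move: mem_m; rewrite -eqD => -[_]; apply.
Qed.

(** * Locating the center of a diamond that is an anticode *)

Lemma anticode_box d (z0 : gpoint) A (P Q S T z1 z2 : gpoint) :
  tristance_anticode d z0 A ->
  A z1 -> A z2 ->
  P \in [:: z0; z1; z2] -> Q \in [:: z0; z1; z2] ->
  S \in [:: z0; z1; z2] -> T \in [:: z0; z1; z2] ->
  (P.1 - Q.1) + (S.2 - T.2) <= d%:Z.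
Proof.
move=> acA A1 A2 iP iQ iS iT; apply: le_trans (tristance_ge_box iP iQ iS iT) _.
by rewrite lez_nat acA.
Qed.

(** The pair already has width [d], which leaves no height for the bounding box with [z0]. *)
Lemma anticode_horizontal_pair d (z0 : gpoint) A (z1 z2 : gpoint) :
  tristance_anticode d z0 A ->
  A z1 -> A z2 -> z1.2 = z2.2 -> z1.1 - z2.1 = d%:Z -> z1.2 = z0.2.
Proof.
move=> acA A1 A2 e2 e1.
have := @anticode_box d z0 A z1 z2 z1 z0 z1 z2 acA A1 A2.
have := @anticode_box d z0 A z1 z2 z0 z1 z1 z2 acA A1 A2.
rewrite !inE !eqxx !orbT /= => /(_ isT isT isT isT) + /(_ isT isT isT isT).
by clear -e1; lia.
Qed.

Lemma anticode_vertical_pair d (z0 : gpoint) A (z1 z2 : gpoint) :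
  tristance_anticode d z0 A ->
  A z1 -> A z2 -> z1.1 = z2.1 -> z1.2 - z2.2 = d%:Z -> z1.1 = z0.1.
Proof.
move=> acA A1 A2 e1 e2.
have := @anticode_box d z0 A z1 z0 z1 z2 z1 z2 acA A1 A2.
have := @anticode_box d z0 A z0 z1 z1 z2 z1 z2 acA A1 A2.
rewrite !inE !eqxx !orbT /= => /(_ isT isT isT isT) + /(_ isT isT isT isT).
by clear -e2; lia.
Qed.

(** Opposite tips are at distance [d]: the horizontal pair fixes the row of [z0], the vertical pair
    its column. *)
Lemma anticode_diamond_center_even d (z0 : gpoint) c1 c2 : ~~ odd d ->
  (2 %| c1)%Z -> (2 %| c2)%Z ->
  tristance_anticode d z0 (diamond d c1 c2) ->
  c1 = 2 * z0.1 /\ c2 = 2 * z0.2.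
Proof.
move=> ed e1 e2 ac.
have [k ek] : exists k : int, d%:Z = 2 * k by exists (d./2)%:Z; lia.
have [p ep] : exists p : int, c1 = 2 * p by exists (c1 %/ 2)%Z; lia.
have [q eq] : exists q : int, c2 = 2 * q by exists (c2 %/ 2)%Z; lia.
have Dr : diamond d c1 c2 (p + k, q) by rewrite /diamond /=; lia.
have Dl : diamond d c1 c2 (p - k, q) by rewrite /diamond /=; lia.
have Du : diamond d c1 c2 (p, q + k) by rewrite /diamond /=; lia.
have Dd : diamond d c1 c2 (p, q - k) by rewrite /diamond /=; lia.
have /= ey : (p + k, q).2 = z0.2.
  by apply: (anticode_horizontal_pair ac Dr Dl) => //=; lia.
have /= ex : (p, q + k).1 = z0.1.
  by apply: (anticode_vertical_pair ac Du Dd) => //=; lia.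
by rewrite ep eq ex ey.
Qed.

(** The horizontal tips fix the row. The top and bottom rows have two points each; a diagonal pair
    spans height [d - 1] and width 1, which confines [z0] to the two middle columns. *)
Lemma anticode_diamond_center_oddl d (z0 : gpoint) c1 c2 : odd d ->
  ~~ (2 %| c1)%Z -> (2 %| c2)%Z ->
  tristance_anticode d z0 (diamond d c1 c2) ->
  (c1 = 2 * z0.1 + 1 \/ c1 = 2 * z0.1 - 1) /\ c2 = 2 * z0.2.
Proof.
move=> od o1 e2 ac.
have [k ek] : exists k : int, d%:Z = 2 * k + 1 by exists (d./2)%:Z; lia.
have [p ep] : exists p : int, c1 = 2 * p + 1 by exists (c1 %/ 2)%Z; lia.
have [q eq] : exists q : int, c2 = 2 * q by exists (c2 %/ 2)%Z; lia.
have Dr : diamond d c1 c2 (p + k + 1, q) by rewrite /diamond /=; lia.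
have Dl : diamond d c1 c2 (p - k, q) by rewrite /diamond /=; lia.
have Du : diamond d c1 c2 (p, q + k) by rewrite /diamond /=; lia.
have Dd : diamond d c1 c2 (p + 1, q - k) by rewrite /diamond /=; lia.
have /= ey : (p + k + 1, q).2 = z0.2.
  by apply: (anticode_horizontal_pair ac Dr Dl) => //=; lia.
have := @anticode_box d z0 _ (p + 1, q - k) z0 (p, q + k) (p + 1, q - k)
  _ _ ac Du Dd.
have := @anticode_box d z0 _ z0 (p, q + k) (p, q + k) (p + 1, q - k)
  _ _ ac Du Dd.
rewrite !inE !eqxx !orbT /= => /(_ isT isT isT isT) + /(_ isT isT isT isT).
by split; lia.
Qed.

Lemma anticode_diamond_center_oddr d (z0 : gpoint) c1 c2 : odd d ->
  (2 %| c1)%Z -> ~~ (2 %| c2)%Z ->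
  tristance_anticode d z0 (diamond d c1 c2) ->
  c1 = 2 * z0.1 /\ (c2 = 2 * z0.2 + 1 \/ c2 = 2 * z0.2 - 1).
Proof.
move=> od e1 o2 ac.
have [k ek] : exists k : int, d%:Z = 2 * k + 1 by exists (d./2)%:Z; lia.
have [p ep] : exists p : int, c1 = 2 * p by exists (c1 %/ 2)%Z; lia.
have [q eq] : exists q : int, c2 = 2 * q + 1 by exists (c2 %/ 2)%Z; lia.
have Du : diamond d c1 c2 (p, q + k + 1) by rewrite /diamond /=; lia.
have Dd : diamond d c1 c2 (p, q - k) by rewrite /diamond /=; lia.
have Dr : diamond d c1 c2 (p + k, q) by rewrite /diamond /=; lia.
have Dl : diamond d c1 c2 (p - k, q + 1) by rewrite /diamond /=; lia.
have /= ex : (p, q + k + 1).1 = z0.1.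
  by apply: (anticode_vertical_pair ac Du Dd) => //=; lia.
have := @anticode_box d z0 _ (p + k, q) (p - k, q + 1) (p - k, q + 1) z0
  _ _ ac Dr Dl.
have := @anticode_box d z0 _ (p + k, q) (p - k, q + 1) z0 (p + k, q)
  _ _ ac Dr Dl.
rewrite !inE !eqxx !orbT /= => /(_ isT isT isT isT) + /(_ isT isT isT isT).
by split; lia.
Qed.

(** * Optimal anticodes are whole diamonds *)

(** The anticode diamond about [z0] is at most as large as [A], and the diamond enclosing [A] is no
    larger than it, unless [d] is even and the enclosing center has odd doubled coordinates; then it
    would be too small to contain [A]. *)
Lemma optimal_anticode_diamond d z0 A : optimal_tristance_anticode d z0 A ->
  exists c1 c2 : int,
    [/\ A = diamond d c1 c2, (2 %| c1 + c2 - d%:Z)%Z &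
        ~~ odd d -> (2 %| c1)%Z].
Proof.
move=> [acA /(_ _ (@diamond_anticode d z0))].
set b1 := _ + _; set b2 := 2 * z0.2 => leBA.
have A0 : A !=set0.
  apply/set0P/eqP => A0; move: leBA; rewrite A0 card_le0 => /eqP B0.
  have : diamond d b1 b2 z0 by rewrite /diamond /= /b1 /b2; lia.
  by rewrite B0.
have [c1 [c2 [par sub]]] := anticode_sub_diamond acA A0.
have even_c : ~~ odd d -> (2 %| c1)%Z.
  move=> ed; apply: contraT => o1.
  have := card_le_trans leBA (subset_card_le sub).
  by apply: contraTT => _; apply: diamond_card_lt => //; rewrite /b1 /b2; lia.
exists c1, c2; split=> //; apply: finite_subset_card_eq sub _.
  exact: finite_diamond.
apply: card_le_trans leBA; apply: diamond_card_le => //.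
  by rewrite /b1 /b2; lia.
have [//|ed] := boolP (odd d); have := even_c ed.
by rewrite /b1 (negbTE ed) /=; lia.
Qed.

Theorem theorem7 (R : realType) (d : nat) (z0 : int * int)
    (A : set (int * int))
    (optA : optimal_tristance_anticode d z0 A) :
  (~~ odd d -> A = L1_ball (d%:R / 2 : R) (point_to_plane R z0)) /\
  (odd d -> exists2 xi : R * R,
     xi \in [:: (2^-1, 0); (0, 2^-1); (- 2^-1, 0); (0, - 2^-1)] &
     A = L1_ball (d%:R / 2 : R) (point_to_plane R z0 + xi)).
Proof.
have [c1 [c2 [eA par even_c]]] := optimal_anticode_diamond optA.
have acA : tristance_anticode d z0 (diamond d c1 c2) by rewrite -eA; case: optA.
have half (x e : int) : (2 * x + e)%:~R / 2 = x%:~R + e%:~R / 2 :> R.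
  by rewrite intrD intrM mulrDl mulrAC divff ?mul1r // pnatr_eq0.
rewrite eA -(L1_ball_half R); split=> [ed|od].
  have e1 := even_c ed.
  have [|-> ->] := anticode_diamond_center_even ed e1 _ acA; first by lia.
  congr L1_ball; rewrite /point_to_plane; congr pair;
    by rewrite -[2 * _]addr0 half mul0r addr0.
(* For odd [d] exactly one of [c1], [c2] is odd; it decides the axis of the shift [xi]. *)
have [e1|o1] := boolP (2 %| c1)%Z.
  have [|-> [] ->] := anticode_diamond_center_oddr od e1 _ acA; first by lia.
    exists (0, 2^-1); first by rewrite !inE eqxx !orbT.
    congr L1_ball; rewrite /point_to_plane; congr pair => /=.
      by rewrite -[2 * _]addr0 half mul0r.
    by rewrite half mul1r.
  exists (0, - 2^-1); first by rewrite !inE eqxx !orbT.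
  congr L1_ball; rewrite /point_to_plane; congr pair => /=.
    by rewrite -[2 * _]addr0 half mul0r.
  by rewrite half mulN1r.
have [|[] -> ->] := anticode_diamond_center_oddl od o1 _ acA; first by lia.
  exists (2^-1, 0); first by rewrite !inE eqxx.
  congr L1_ball; rewrite /point_to_plane; congr pair => /=.
    by rewrite half mul1r.
  by rewrite -[2 * _]addr0 half mul0r.
exists (- 2^-1, 0); first by rewrite !inE eqxx !orbT.
congr L1_ball; rewrite /point_to_plane; congr pair => /=.
  by rewrite half mulN1r.
by rewrite -[2 * _]addr0 half mul0r.
Qed.
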